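(* Let $\alpha,\beta>-1$ and $-1<\overline{\alpha}<0$, $-1<\overline{\beta}<0$. The measures $$\mu_{\overline{\alpha},\overline{\beta}}(dx)=(1-x)^{\overline{\alpha}}(1+x)^{\overline{\beta}}\,dx,\qquad \overline{\alpha}+\overline{\beta}>-1,$$ are $A_1$ weights with respect to the Jacobi measure $J^{\alpha,\beta}(dx)=(1-x)^{\alpha}(1+x)^{\beta}\,dx$, $\alpha+\beta>-1$, on $[-1,1]$.
   Context: For a measure $\mu$ on an interval, the non-centered Hardy–Littlewood maximal function of a function $f\ge 0$ is $f^*_{\mu}(x)=\sup_{x\in I}\frac{1}{\mu(I)}\int_I f(y)\,\mu(dy)$, the supremum being over subintervals $I$ of the given interval containing $x$. A function $\omega>0$ is an $A_1$ weight with respect to $\mu$ if there is a constant $C_1$ with $\omega^*_{\mu}(x)\le C_1\,\omega(x)$. Saying that a measure $\omega(x)\,dx$ is an $A_1$ weight with respect to $\mu$ means that its density $\omega$ is.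
   Formalization: The formal theorem adds the hypotheses α+ᾱ > −1 and β+β̄ > −1 (integrability of the weight against the Jacobi measure); without either one the maximal function is infinite everywhere and the claim fails, e.g. α=−1/2, β=0, ᾱ=−3/4, β̄=−1/10. *)

(* Defs.v *)
From HB Require Import structures.
From mathcomp Require Import all_boot all_order all_algebra.
From mathcomp Require Import all_classical all_reals all_analysis.
From mathcomp Require Import measurable_realfun.

Set Implicit Arguments.
Unset Strict Implicit.
Unset Printing Implicit Defensive.

Import Order.TTheory GRing.Theory Num.Theory.

Local Open Scope classical_set_scope.
Local Open Scope ring_scope.

(* Real power on [0, +oo[ with the value +oo for a negative power of 0; the
   library's powR has 0 `^ s = 0 for every s != 0, including s < 0. *)
Definition epow {R : realType} (t s : R) : \bar R :=
  if (t == 0) && (s < 0) then +oo%E else (t `^ s)%:E.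

(* (1 - x)^a (1 + x)^b, meant for x in [-1, 1]. *)
Definition jacobi_density {R : realType} (a b x : R) : \bar R :=
  (epow (1 - x) a * epow (1 + x) b)%E.

Section jacobi_measure.
Context {R : realType}.
Variables a b : R.

Lemma epow_ge0 (t s : R) : (0 <= epow t s)%E.
Proof. by rewrite /epow; case: ifPn; rewrite ?leey// lee_fin powR_ge0. Qed.

Lemma jacobi_density_ge0 x : (0 <= jacobi_density a b x)%E.
Proof. by rewrite mule_ge0 ?epow_ge0. Qed.

Lemma measurable_epow (s : R) :
  measurable_fun [set: R] (epow ^~ s : R -> \bar R).
Proof.
apply: measurable_fun_if => //=.
- apply: measurable_and => //; exact: measurable_fun_eqr.
- apply: measurable_funTS; apply/measurable_EFinP; exact: measurable_powR.
Qed.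

Lemma measurable_jacobi_density :
  measurable_fun [set: R] (jacobi_density a b).
Proof.
apply: emeasurable_funM; apply: (measurableT_comp (measurable_epow _)).
- exact: measurable_funB.
- exact: measurable_funD.
Qed.

Definition jacobi_measure (A : set R) : \bar R :=
  (\int[@lebesgue_measure R]_(x in A `&` `[(-1)%R, 1%R]) jacobi_density a b x)%E.

Let jacobi_measure0 : jacobi_measure set0 = 0%E.
Proof. by rewrite /jacobi_measure set0I integral_set0. Qed.

Let jacobi_measure_ge0 A : (0 <= jacobi_measure A)%E.
Proof. by apply: integral_ge0 => x _; exact: jacobi_density_ge0. Qed.

Let jacobi_measure_sigma_additive : semi_sigma_additive jacobi_measure.
Proof.
rewrite (_ : jacobi_measure = fun A =>
  (\int[@lebesgue_measure R]_(x in A)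
     ((jacobi_density a b) \_ `[(-1)%R, 1%R]) x)%E); last first.
  by apply/funext => A; rewrite /jacobi_measure integral_mkcondr.
apply: (@semi_sigma_additive_nng_induced _ _ R (@lebesgue_measure R)
  ((jacobi_density a b) \_ `[-1, 1])).
- apply/(measurable_restrictT _ _).1; first exact: measurable_itv.
  by apply: measurable_funTS; exact: measurable_jacobi_density.
- by move=> x; apply: erestrict_ge0 => y _; exact: jacobi_density_ge0.
Qed.

HB.instance Definition _ := isMeasure.Build _ _ _ jacobi_measure
  jacobi_measure0 jacobi_measure_ge0 jacobi_measure_sigma_additive.

End jacobi_measure.

(* Only subintervals of positive finite measure have a well-defined average. *)
Definition noncentered_maximal {R : realType} (D : set R)
    (mu : {measure set R -> \bar R}) (f : R -> \bar R) (x : R) : \bar R :=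
  ereal_sup [set (\int[mu]_(y in I) f y / mu I)%E | I in
    [set I : set R | [/\ is_interval I, I `<=` D, I x & (0 < mu I < +oo)%E]]].

(* The weight may be +oo at some points, as (1 - x)^a with a < 0 is at x = 1. *)
Definition A1_weight {R : realType} (D : set R)
    (mu : {measure set R -> \bar R}) (w : R -> \bar R) : Prop :=
  (forall x, D x -> (0 < w x)%E) /\
  (exists C : R, forall x, D x ->
     (noncentered_maximal D mu w x <= C%:E * w x)%E).

(* Main.v *)
(* Write t = 1 - x and s = 1 + x. Since max(t, s) >= 1 on [-1, 1], the weight
   t^a' s^b' is comparable to t^a' + s^b', so by symmetry it suffices to bound
   the average of t^a' over an interval I containing x by a multiple of
   t(x)^a'. Put r = t(x) / 2. On the points of I with t >= r the bound is
   immediate, as a' < 0. If I also has points with t < r, then it contains the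
   slab r <= t <= 3r/2. The Jacobi measure of the layer
   r 2^-(k+1) <= t < r 2^-k is at most a constant times 2^(-(a+1)(k+1)) times
   the measure of that slab, and t^a' <= r^a' 2^(-a'(k+1)) on the layer, so the
   integrals over the layers are dominated by a geometric series of ratio
   2^-(a+a'+1) < 1. *)

Require Import Defs.
From mathcomp Require Import all_boot all_order all_algebra.
From mathcomp Require Import all_classical all_reals all_analysis.
From mathcomp Require Import measurable_realfun.
From mathcomp Require Import lra ring.

Import Order.TTheory GRing.Theory Num.Theory.

Local Open Scope classical_set_scope.
Local Open Scope ring_scope.

(** * Real powers, doubling estimates and geometric series *)

Section powers.
Context {R : realType}.
Implicit Types (r s t p : R).

Lemma epowE t p : 0 < t -> epow t p = (t `^ p)%:E.
Proof. by move=> t0; rewrite /epow gt_eqF. Qed.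

Lemma epow_gt0 t p : 0 <= t -> t != 0 \/ p < 0 -> (0 < epow t p)%E.
Proof.
move=> t0 tp; rewrite /epow; have [t_0|tn0] /= := eqVneq t 0; last first.
  by rewrite lte_fin powR_gt0// lt_neqAle eq_sym tn0.
by case: tp => [|->]; rewrite ?t_0 ?eqxx ?lt0y.
Qed.

Lemma le_powR_npos {p r s} : p <= 0 -> 0 < r -> r <= s -> s `^ p <= r `^ p.
Proof.
move=> p0 r0 rs; rewrite /powR !gt_eqF ?(lt_le_trans r0)// ler_expR.
by rewrite ler_wnM2l// ler_ln// posrE (lt_le_trans r0).
Qed.

Lemma le_epow_npos {p r s} : p <= 0 -> 0 < r -> r <= s ->
  (epow s p <= (r `^ p)%:E)%E.
Proof.
by move=> p0 r0 rs; rewrite epowE ?(lt_le_trans r0)// lee_fin le_powR_npos.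
Qed.

(** The hypotheses amount to [|ln s - ln r| <= ln 2]; multiply by [p] and exponentiate. Both signs
    of [p] are covered. *)
Lemma powR_comparable p r s : 0 < r -> r / 2 <= s -> s <= 2 * r ->
  s `^ p <= 2 `^ `|p| * r `^ p.
Proof.
move=> r0 rs sr; have s0 : 0 < s by lra.
rewrite /powR !gt_eqF// -expRD ler_expR.
have ln_sr : ln s <= ln 2 + ln r by rewrite -lnM ?posrE// ler_ln ?posrE//; lra.
have ln_rs : ln r <= ln 2 + ln s by rewrite -lnM ?posrE// ler_ln ?posrE//; lra.
rewrite -lerBlDr -mulrBr (le_trans (ler_norm _))// normrM ler_wpM2l//.
by rewrite ler_norml; apply/andP; split; lra.
Qed.

Lemma powR_half_expn p n : (2^-1 ^+ n) `^ p = (2 `^ (- p)) ^+ n.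
Proof.
have e : 2^-1 `^ p = 2 `^ (- p) by rewrite -powR_inv1// -powRrM mulN1r.
rewrite -e -[in LHS]powR_mulrn ?invr_ge0// -[RHS]powR_mulrn ?powR_ge0//.
by rewrite powRAC.
Qed.

Lemma expr_half_small r : 0 < r -> exists n, 2^-1 ^+ n <= r.
Proof.
(* This [n] exceeds [r^-1], and [n < 2 ^ n]. *)
move=> r0; exists (Num.bound r^-1).
rewrite exprVn -[leRHS]invrK lef_pV2 ?posrE ?exprn_gt0 ?invr_gt0//.
apply: (le_trans (ltW (archi_boundP _))); first by rewrite invr_ge0 ltW.
by rewrite -natrX ler_nat ltnW// ltn_expl.
Qed.

Lemma powR2_lt1 (t : R) : t < 0 -> 2 `^ t < 1.
Proof.
move=> t0; rewrite /powR gt_eqF// -[ltRHS]expR0 ltr_expR.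
by rewrite nmulr_rlt0// ln_gt0// ltr1n.
Qed.

(** The exponent [k.+1] fits layers numbered from 0: the majorant starts at [x], hence the sum
    [x / (1 - x)]. *)
Lemma nneseries_geometric_le (u : nat -> \bar R) (B x : R) : 0 <= B ->
  0 < x < 1 -> (forall k, 0 <= u k)%E ->
  (forall k, u k <= (B * x ^+ k.+1)%:E)%E ->
  (\sum_(0 <= k <oo) u k <= (B * (x / (1 - x)))%:E)%E.
Proof.
move=> B0 /andP[x0 x1] u0 uB; apply: lime_le.
  by apply: is_cvg_nneseries => k _ _; exact: u0.
apply: nearW => n; apply: (@le_trans _ _ (B * series (geometric x x) n)%:E).
  rewrite seriesEnat/= mulr_sumr -sumEFin; apply: lee_sum => k _.
  by rewrite -exprS.
by rewrite lee_fin ler_wpM2l// geometric_le_lim ?ltW// gtr0_norm.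
Qed.

End powers.

(** * Dyadic layers around an endpoint of [-1, 1] *)

Section dyadic_layers.
Context {R : realType}.
Implicit Types (c : bool) (r l u : R).

(* The distance from y to -1 if c, and to 1 otherwise. *)
Definition side c (y : R) : R := if c then 1 + y else 1 - y.

Lemma sideN c y : side (~~ c) y = 2 - side c y.
Proof. by case: c; rewrite /side/=; lra. Qed.

Lemma side_itvE c y : (y \in `[(-1)%R, 1%R]) = (0 <= side c y <= 2).
Proof. by rewrite in_itv/= /side; case: c; apply/idP/idP => /andP[] *; lra. Qed.

Lemma measurable_side c : measurable_fun [set: R] (side c).
Proof. by case: c; [exact: measurable_funD|exact: measurable_funB]. Qed.

Lemma measurable_side_eq0 c : measurable [set y : R | side c y = 0].
Proof.
rewrite [X in measurable X](_ : _ = side c @^-1` [set 0])//.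
by rewrite -[X in measurable X]setTI; apply: measurable_side.
Qed.

Definition slab c l u : set R := [set y | l <= side c y <= u].

(** Half-open, so that distinct layers are disjoint; for [r > 0] no layer contains the endpoint
    itself. *)
Definition layer c r k : set R :=
  [set y | r * 2^-1 ^+ k.+1 <= side c y < r * 2^-1 ^+ k].

Lemma slabE c l u :
  slab c l u = if c then `[l - 1, u - 1]%classic else `[1 - u, 1 - l]%classic.
Proof.
rewrite /slab /side; case: c; apply/seteqP; split => y /=;
  by rewrite ?in_itv/= => /andP[? ?]; lra.
Qed.

Lemma measurable_slab c l u : measurable (slab c l u).
Proof. by rewrite slabE; case: c; exact: measurable_itv. Qed.

Lemma lebesgue_slab c l u : l <= u ->
  lebesgue_measure (slab c l u) = (u - l)%:E.
Proof.
rewrite le_eqVlt => /predU1P[->|lu]; rewrite slabE; case: c;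
  rewrite lebesgue_measure_itv/= lte_fin.
- by rewrite ltxx subrr.
- by rewrite ltxx subrr.
- by rewrite ifT ?ltrD2r// -EFinD; congr EFin; lra.
- by rewrite ifT ?ltrD2l ?ltrN2// -EFinD; congr EFin; lra.
Qed.

Definition cap c r : set R := [set y | side c y < r].

Lemma measurable_cap c r : measurable (cap c r).
Proof.
rewrite [cap _ _](_ : _ = side c @^-1` `]-oo, r[%classic).
  by rewrite -[X in measurable X]setTI; apply: measurable_side.
by apply/seteqP; split => y; rewrite /cap/= in_itv.
Qed.

Lemma measurable_layer c r k : measurable (layer c r k).
Proof.
rewrite [layer _ _ _](_ : _ = side c @^-1`
  `[r * 2^-1 ^+ k.+1, r * 2^-1 ^+ k[%classic).
  by rewrite -[X in measurable X]setTI; apply: measurable_side.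
by apply/seteqP; split => y; rewrite /layer/= in_itv.
Qed.

Lemma trivIset_layer c r : 0 < r -> trivIset [set: nat] (layer c r).
Proof.
move=> r0; apply/trivIsetP => /= i j _ _; wlog : i j / (i < j)%N.
  by move=> H; rewrite neq_ltn => /orP[] ij; [|rewrite setIC];
    apply: H => //; rewrite neq_ltn ij ?orbT.
move=> ij _; rewrite -subset0 => y [/andP[iy _] /andP[_ /(le_lt_trans iy)]].
by rewrite ltr_pM2l// ltNge ler_wiXn2l ?invr_ge0// invf_le1 ?ler1n.
Qed.

Lemma layer_cover c r y : 0 < r -> 0 < side c y < r ->
  (\bigcup_k layer c r k) y.
Proof.
move=> r0 /andP[y0 yr]; have h : exists n, r * 2^-1 ^+ n <= side c y.
  have [n hn] := expr_half_small _ (divr_gt0 y0 r0).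
  by exists n; rewrite mulrC -ler_pdivlMr.
(* The least such [n] is not 0 because [side c y < r]; writing it as [k.+1], minimality gives the
   upper bound of layer [k]. *)
case: (ex_minnP h) => -[|k]; first by rewrite expr0 mulr1 leNgt yr.
move=> ky kmin; exists k => //; rewrite /layer/= ky/= ltNge.
by apply/negP => /kmin; rewrite ltnn.
Qed.

End dyadic_layers.

(** * Integrals of a power of the distance to one endpoint *)

Section jacobi_layers.
Context {R : realType}.
Variables (c : bool) (p q : R).
Implicit Types (r l u y s C : R) (I : set R).

(* The density (1 - x)^a (1 + x)^b has exponent p at the endpoint selected by c
   and exponent q at the other one. *)
Let a := if c then q else p.
Let b := if c then p else q.
Let J : {measure set R -> \bar R} := jacobi_measure a b.
(** Comparability constant for the density on a slab: one doubling factor for each endpoint. *)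
Let K : R := 2 `^ `|p| * 2 `^ `|q|.

Lemma jacobi_densityE y :
  jacobi_density a b y = (epow (side c y) p * epow (2 - side c y) q)%E.
Proof.
by rewrite /jacobi_density /a /b -sideN; case: (c); rewrite // muleC.
Qed.

Lemma slab_subset l u : 0 <= l -> u <= 2 -> slab c l u `<=` (`[-1, 1] : set R).
Proof.
by move=> l0 u2 y /andP[ly yu]; rewrite /= (side_itvE c); apply/andP; split;
  lra.
Qed.

Lemma K_gt0 : 0 < K. Proof. by rewrite mulr_gt0 ?powR_gt0. Qed.

Lemma jacobi_density_slab l u y : 0 < l -> u <= 2 * l -> u <= 3 / 2 ->
  slab c l u y ->
  ((K^-1 * l `^ p)%:E <= jacobi_density a b y <= (K * l `^ p)%:E)%E.
Proof.
move=> l0 ul u32 /andP[ly yu]; have t0 : 0 < side c y by lra.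
have s0 : 0 < 2 - side c y by lra.
rewrite jacobi_densityE !epowE// -EFinM !lee_fin ler_pdivrMl ?K_gt0//.
have tl := @powR_comparable _ p l (side c y) ltac:(lra) ltac:(lra) ltac:(lra).
have lt := @powR_comparable _ p (side c y) l ltac:(lra) ltac:(lra) ltac:(lra).
(* Since [u <= 3 / 2], the distance to the other endpoint lies between 1/2 and 2, so its power is
   comparable to 1. *)
have s1 := @powR_comparable _ q 1 (2 - side c y)
  ltac:(lra) ltac:(lra) ltac:(lra).
have s2 := @powR_comparable _ q (2 - side c y) 1
  ltac:(lra) ltac:(lra) ltac:(lra).
rewrite powR1 in s1 s2.
apply/andP; split.
  by rewrite -[leLHS]mulr1 mulrACA ler_pM// powR_ge0.
rewrite mulrAC; have := ler_pM (powR_ge0 _ _) (powR_ge0 _ _) tl s1.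
by rewrite mulr1.
Qed.

Lemma jacobi_measure_slab l u : 0 < l -> l <= u -> u <= 2 * l -> u <= 3 / 2 ->
  ((K^-1 * l `^ p * (u - l))%:E <= J (slab c l u) <=
   (K * l `^ p * (u - l))%:E)%E.
Proof.
move=> l0 lu ul u32; have mS := measurable_slab c l u.
rewrite /J/= /jacobi_measure (setIidl (slab_subset _ _ (ltW l0) _)); last lra.
have mJ : measurable_fun (slab c l u) (jacobi_density a b).
  by apply: measurable_funTS; exact: measurable_jacobi_density.
rewrite (EFinM _ (u - l)) (EFinM (K * _)) -!(lebesgue_slab c _ _ lu).
rewrite -!integral_cst//; apply/andP; split; apply: ge0_le_integral => //=.
- by move=> _ _; rewrite lee_fin mulr_ge0 ?powR_ge0// invr_ge0 ltW// K_gt0.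
- by move=> y /(jacobi_density_slab _ _ _ l0 ul u32)/andP[].
- by move=> y _; exact: jacobi_density_ge0.
- by move=> y /(jacobi_density_slab _ _ _ l0 ul u32)/andP[].
Qed.

Lemma jacobi_measure_slab_fin_num r : 0 < r <= 1 ->
  J (slab c r (3 / 2 * r)) \is a fin_num.
Proof.
move=> /andP[r0 r1]; have /andP[_ h] := jacobi_measure_slab r (3 / 2 * r)
  ltac:(lra) ltac:(lra) ltac:(lra) ltac:(lra).
by rewrite ge0_fin_numE ?measure_ge0// (le_lt_trans h)// ltry.
Qed.

(** With [h = 2^-(k+1)], the layer lies in the slab from [r * h] to [2 * (r * h)], of measure at
    most [K (r h)^p r h]. The reference slab has length [r / 2] and measure at least
    [K^-1 r^p r / 2]; the quotient of the two bounds is [2 K^2 h^(p+1)]. *)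
Lemma jacobi_measure_layer r k : 0 < r <= 1 ->
  (J (layer c r k) <=
   (2 * K ^+ 2 * (2 `^ (- p) / 2) ^+ k.+1)%:E *
     J (slab c r (3 / 2 * r)))%E.
Proof.
move=> /andP[r0 r1]; set h : R := 2^-1 ^+ k.+1.
have h0 : 0 < h by rewrite exprn_gt0// invr_gt0.
have h1 : h <= 2^-1.
  by rewrite /h exprS ler_piMr ?invr_ge0// exprn_ile1 ?invr_ge0// invf_le1
    ?ler1n.
have rh : r * h <= 2^-1 by rewrite -[leRHS]mul1r ler_pM// ltW.
have rh0 : 0 < r * h by rewrite mulr_gt0.
have /andP[_ ub] := jacobi_measure_slab (r * h) (2 * (r * h))
  ltac:(lra) ltac:(lra) ltac:(lra) ltac:(lra).
have /andP[lb _] := jacobi_measure_slab r (3 / 2 * r)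
  ltac:(lra) ltac:(lra) ltac:(lra) ltac:(lra).
have le : (J (layer c r k) <=
    J (slab c (r * h) (2 * (r * h))))%E.
  apply: le_measure; rewrite ?inE.
  - exact: measurable_layer.
  - exact: measurable_slab.
  move=> y /andP[hy yh]; rewrite /slab/= hy/= (le_trans (ltW yh))//.
  by rewrite /h exprS; lra.
apply: (le_trans le); apply: (le_trans ub).
apply: (le_trans _ (lee_wpmul2l _ lb)); last first.
  by rewrite lee_fin !mulr_ge0 ?exprn_ge0 ?ltW ?K_gt0// ?divr_ge0 ?powR_ge0.
have r_ge0 := ltW r0; have h_ge0 := ltW h0.
rewrite -EFinM lee_fin powRM// /h powR_half_expn [(_ / 2) ^+ _]exprMn -/h.
rewrite le_eqVlt; apply/orP; left; apply/eqP.
by have := K_gt0; move: K => k0 k00; field; rewrite gt_eqF.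
Qed.

(** A single point is Lebesgue null, even if the density is infinite there. *)
Lemma jacobi_measure_end : J [set y | side c y = 0] = 0%E.
Proof.
apply: (@integral_Sset1 _ _ _ (if c then - 1 else 1)) => y [/=].
by rewrite /side; case: (c) => ? _; lra.
Qed.


Lemma measurable_epow_side s D :
  measurable_fun D (fun y => epow (side c y) s).
Proof.
apply: measurable_funTS.
exact: (measurableT_comp (measurable_epow s) (measurable_side c)).
Qed.

(** As [s <= 0], the integrand is at most its value at the layer's smallest distance, which
    multiplies the bound on the layer's measure. *)
Lemma integral_layer s r k : s <= 0 -> 0 < r <= 1 ->
  (\int[J]_(y in layer c r k) epow (side c y) s <=
   (r `^ s * (2 * K ^+ 2) * (2 `^ (- s) * (2 `^ (- p) / 2)) ^+ k.+1)%:E *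
     J (slab c r (3 / 2 * r)))%E.
Proof.
move=> s0 r01; have r0 : 0 < r by case/andP: r01.
have h0 : 0 < (2^-1 : R) ^+ k.+1 by rewrite exprn_gt0// invr_gt0.
have mL := measurable_layer c r k.
apply: (@le_trans _ _ (\int[J]_(y in layer c r k)
    cst ((r * 2^-1 ^+ k.+1) `^ s)%:E y)%E).
  apply: ge0_le_integral => //.
  - by move=> y _; exact: epow_ge0.
  - exact: measurable_epow_side.
  - by move=> y /andP[hy _]; apply: le_epow_npos => //; rewrite mulr_gt0.
rewrite integral_cst//.
apply: (le_trans (lee_wpmul2l _ (jacobi_measure_layer r k r01))).
  by rewrite lee_fin powR_ge0.
have r_ge0 := ltW r0; have h_ge0 := ltW h0.
rewrite muleA -EFinM powRM// powR_half_expn.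
rewrite [(2 `^ (- s) * (_ / 2)) ^+ _]exprMn lee_wpmul2r ?measure_ge0// lee_fin.
by rewrite le_eqVlt; apply/orP; left; apply/eqP; ring.
Qed.

Lemma integral_side_tail s : s <= 0 -> -1 < p + s ->
  exists2 C : R, 0 < C & forall r I, 0 < r <= 1 -> measurable I ->
    I `<=` (`[-1, 1] : set R) ->
    (\int[J]_(y in I `&` cap c r)
       epow (side c y) s <=
     (C * r `^ s)%:E * J (slab c r (3 / 2 * r)))%E.
Proof.
(* The ratio of the geometric series, equal to [2^-(p+s+1)]; [-1 < p + s] makes it less than 1. *)
move=> s0 ps; pose x : R := 2 `^ (- s) * (2 `^ (- p) / 2).
have x0 : 0 < x by rewrite mulr_gt0 ?divr_gt0 ?powR_gt0.
have x1 : x < 1.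
  suff -> : x = 2 `^ (- s - p - 1) by rewrite powR2_lt1//; lra.
  by rewrite /x !powRD ?pnatr_eq0 ?implybT// powR_inv1// mulrA.
have C0 : 0 < 2 * K ^+ 2 * (x / (1 - x)).
  by rewrite mulr_gt0 ?divr_gt0 ?subr_gt0// mulr_gt0// exprn_gt0// K_gt0.
exists (2 * K ^+ 2 * (x / (1 - x))) => // r I r01 mI I11.
have r0 : 0 < r by case/andP: r01.
have mlt : measurable (I `&` cap c r).
  by apply: measurableI => //; exact: measurable_cap.
have mend := @measurable_side_eq0 R c.
(* The layers miss the endpoint, where the integrand is [+oo] if [s < 0]; this null set is removed
   first. *)
rewrite (ge0_negligible_integral mend mlt); last first.
- exact: jacobi_measure_end.
- by move=> y _; exact: epow_ge0.
- exact: measurable_epow_side.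
have mL k : measurable (layer c r k) by exact: measurable_layer.
apply: (@le_trans _ _ (\int[J]_(y in \bigcup_k layer c r k)
    epow (side c y) s)%E).
  apply: ge0_subset_integral.
  - exact: measurableD.
  - exact: bigcupT_measurable.
  - exact: measurable_epow_side.
  - by move=> y _; exact: epow_ge0.
  move=> y [[/I11 + yr] /eqP y0]; rewrite /= (side_itvE c) => /andP[ty _].
  by apply: layer_cover => //; rewrite yr lt_neqAle eq_sym y0 ty.
rewrite ge0_integral_bigcup//; last 3 first.
- exact: measurable_epow_side.
- by move=> y _; exact: epow_ge0.
- exact: trivIset_layer.
have := jacobi_measure_slab_fin_num r r01.
have J0 : (0 <= J (slab c r (3 / 2 * r)))%E by exact: measure_ge0.
have := fun k => integral_layer s r k s0 r01.
case: (J (slab _ _ _)) J0 => // m m0 lay _.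
rewrite -EFinM (_ : _ * m = r `^ s * (2 * K ^+ 2) * m * (x / (1 - x)));
  last lra.
apply: nneseries_geometric_le.
- rewrite lee_fin in m0; rewrite mulr_ge0// mulr_ge0 ?powR_ge0//.
  by rewrite mulr_ge0// exprn_ge0// ltW// K_gt0.
- by rewrite x0 x1.
- by move=> k; apply: integral_ge0 => y _; exact: epow_ge0.
- by move=> k; apply: (le_trans (lay k)); rewrite -EFinM -/x mulrAC.
Qed.

Lemma integral_side_le s : s <= 0 -> -1 < p + s ->
  exists2 C : R, 0 < C & forall x I, is_interval I ->
    I `<=` (`[-1, 1] : set R) -> I x -> 0 < side c x ->
    (\int[J]_(y in I) epow (side c y) s <=
     (C * side c x `^ s)%:E * J I)%E.
Proof.
move=> s0 ps; have [C C0 tail] := integral_side_tail s s0 ps.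
(* The factor [2^(-s)] turns [(side c x)^s] into [r^s] for [r = side c x / 2]; 1 accounts for the
   points at distance at least [r], [C] for the others. *)
exists (2 `^ (- s) * (1 + C)) => [|x I itvI I11 Ix tx].
  by rewrite mulr_gt0 ?powR_gt0// addr_gt0.
have mI : measurable I by exact: is_interval_measurable.
pose r := side c x / 2.
have : (-1 <= x <= 1) by have := I11 _ Ix; rewrite /= in_itv.
have := I11 _ Ix; rewrite /= (side_itvE c) => /andP[_ x2] _.
have r01 : 0 < r <= 1 by rewrite /r; apply/andP; split; lra.
have r0 : 0 < r by case/andP: r01.
have -> : 2 `^ (- s) * (1 + C) * side c x `^ s = r `^ s + C * r `^ s.
  rewrite /r powRM ?invr_ge0 ?(ltW tx)//.
  have -> : 2^-1 `^ s = 2 `^ (- s) :> R.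
    by rewrite -powR_inv1// -powRrM mulN1r.
  by lra.
pose A := cap c r; have mA : measurable A by exact: measurable_cap.
have mIA : measurable (I `\` A) by exact: measurableD.
have mIA' : measurable (I `&` A) by exact: measurableI.
rewrite -[X in integral _ X](setDUK (@subIsetl _ I A)) setDIr setDv set0U setUC.
rewrite ge0_integral_setU//=; last 3 first.
- exact: measurable_epow_side.
- by move=> y _; exact: epow_ge0.
- by apply/disj_setPS => y [[_ nA] [_ /nA]].
rewrite EFinD ge0_muleDl ?lee_fin ?mulr_ge0 ?powR_ge0 ?(ltW C0)//.
apply: leeD.
  apply: (@le_trans _ _ (\int[J]_(y in I `\` A) cst (r `^ s)%:E y)%E).
    apply: ge0_le_integral => //.
    - by move=> y _; exact: epow_ge0.
    - exact: measurable_epow_side.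
    - by move=> y [_ /negP]; rewrite -leNgt => ry; exact: le_epow_npos.
  rewrite integral_cst// lee_wpmul2l ?lee_fin ?powR_ge0//.
  by apply: le_measure; rewrite ?inE//; exact: subDsetl.
have [IA0|/set0P[z [Iz zr]]] := eqVneq (I `&` A) set0.
  by rewrite IA0 integral_set0 mule_ge0// lee_fin mulr_ge0 ?powR_ge0 ?(ltW C0).
apply: (le_trans (tail r I r01 mI I11)).
rewrite lee_wpmul2l ?lee_fin ?mulr_ge0 ?powR_ge0 ?(ltW C0)//.
apply: le_measure; rewrite ?inE//; first exact: measurable_slab.
move=> y /andP[ry yr].
(* Each point of the slab lies between [z] and [x], as [3 / 2 * r <= side c x], so the interval [I]
   contains it. *)
have zy : side c z <= side c y by rewrite (le_trans _ ry)// ltW.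
have yx : side c y <= side c x by rewrite (le_trans yr)// /r; lra.
case: (c) zy yx; rewrite /side => zy yx.
- by apply: (itvI z x); rewrite //; apply/andP; split; lra.
- by apply: (itvI x z); rewrite //; apply/andP; split; lra.
Qed.
End jacobi_layers.

(** * Comparison of the two-sided weight with the sum of one-sided powers *)

Section jacobi_weights.
Context {R : realType}.
Implicit Types (p q x y : R).

Lemma lee_ediv (m F G : \bar R) : (0 < m < +oo)%E -> (F <= G * m)%E ->
  (F / m <= G)%E.
Proof.
case: m => [m| |] /andP[]; rewrite ?ltxx// lte_fin => m0 _.
by rewrite inver gt_eqF// lee_pdivrMr.
Qed.

(** The distance to the farther endpoint is at least 1, so its factor is at most 1. *)
Lemma jacobi_density_le p q y : p <= 0 -> q <= 0 -> -1 <= y <= 1 ->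
  (jacobi_density p q y <= epow (side false y) p + epow (side true y) q)%E.
Proof.
move=> p0 q0 /andP[y0 y1]; rewrite /jacobi_density /side.
have pow1 (t s : R) : s <= 0 -> 1 <= t -> (epow t s <= 1)%E.
  by move=> s0 t1; have := le_epow_npos s0 ltr01 t1; rewrite powR1.
have [y_ge0|y_lt0] := leP 0 y.
  apply: (@le_trans _ _ (epow (1 - y) p)); last by rewrite leeDl// epow_ge0.
  by rewrite -[leRHS]mule1 lee_wpmul2l ?epow_ge0// pow1//; lra.
apply: (@le_trans _ _ (epow (1 + y) q)); last by rewrite leeDr// epow_ge0.
by rewrite -[leRHS]mul1e lee_wpmul2r ?epow_ge0// pow1//; lra.
Qed.

Lemma jacobi_density_gt0 p q x : p < 0 -> q < 0 -> -1 <= x <= 1 ->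
  (0 < jacobi_density p q x)%E.
Proof.
move=> p0 q0 /andP[x0 x1].
by apply: mule_gt0; (apply: epow_gt0; [lra|right]).
Qed.

Lemma jacobi_density_end p q x : p < 0 -> q < 0 -> x = 1 \/ x = -1 ->
  jacobi_density p q x = +oo%E.
Proof.
move=> p0 q0 x1.
have inf s : s < 0 -> epow (0 : R) s = +oo%E by rewrite /epow eqxx => ->.
rewrite /jacobi_density; case: x1 => ->.
  by rewrite subrr inf// gt0_mulye//; apply: epow_gt0; [lra|right].
by rewrite subrr inf// gt0_muley//; apply: epow_gt0; [lra|right].
Qed.

(** Both distances are at most 2, so either factor can be bounded below by 2 to its exponent; the
    two resulting bounds are added. *)
Lemma jacobi_density_ge p q x : p <= 0 -> q <= 0 -> -1 < x < 1 ->
  ((2 `^ p * side true x `^ q + 2 `^ q * side false x `^ p)%:E <=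
   2%:E * jacobi_density p q x)%E.
Proof.
move=> p0 q0 /andP[x0 x1]; rewrite /jacobi_density /side.
have t0 : 0 < 1 - x by lra.
have s0 : 0 < 1 + x by lra.
have tp : 2 `^ p <= (1 - x) `^ p by rewrite le_powR_npos//; lra.
have sq : 2 `^ q <= (1 + x) `^ q by rewrite le_powR_npos//; lra.
rewrite !epowE// -!EFinM lee_fin mulr_natl mulr2n lerD//.
  by rewrite ler_wpM2r// powR_ge0.
by rewrite mulrC ler_wpM2l// powR_ge0.
Qed.

Lemma integral_jacobi_density_le (mu : {measure set R -> \bar R}) p q I :
  p <= 0 -> q <= 0 -> measurable I -> I `<=` (`[-1, 1] : set R) ->
  (\int[mu]_(y in I) jacobi_density p q y <=
   \int[mu]_(y in I) epow (side false y) p +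
   \int[mu]_(y in I) epow (side true y) q)%E.
Proof.
move=> p0 q0 mI I11.
have mf := measurable_epow_side false p I.
have mt := measurable_epow_side true q I.
rewrite -ge0_integralD//; [|by move=> y _; exact: epow_ge0..].
apply: ge0_le_integral => //.
- by move=> y _; exact: jacobi_density_ge0.
- by apply: measurable_funTS; exact: measurable_jacobi_density.
- exact: emeasurable_funD.
- by move=> y /I11; rewrite /= in_itv/= => ?; exact: jacobi_density_le.
Qed.

End jacobi_weights.

(* The last two hypotheses say that (1 - x)^a' (1 + x)^b' is integrable with
   respect to the Jacobi measure; otherwise its maximal function is +oo
   everywhere and the conclusion fails. *)
Theorem theorem3p4 (R : realType) (alpha beta alpha' beta' : R)
    (ha : -1 < alpha) (hb : -1 < beta)
    (ha' : -1 < alpha' < 0) (hb' : -1 < beta' < 0)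
    (hab' : -1 < alpha' + beta') (hab : -1 < alpha + beta)
    (haa' : -1 < alpha + alpha') (hbb' : -1 < beta + beta') :
  A1_weight `[-1, 1] (jacobi_measure alpha beta) (jacobi_density alpha' beta').
Proof.
case/andP: ha' => _ a'0; case/andP: hb' => _ b'0.
(* One bound per endpoint; the exponents swap roles for the endpoint -1. *)
have [Cf Cf0 hf] := @integral_side_le R false alpha beta alpha' (ltW a'0) haa'.
have [Ct Ct0 ht] := @integral_side_le R true beta alpha beta' (ltW b'0) hbb'.
rewrite /= in hf ht.
(* Normalised to match the coefficients in [jacobi_density_ge]. *)
pose Df := Cf / 2 `^ beta'; pose Dt := Ct / 2 `^ alpha'.
have Df0 : 0 < Df by rewrite divr_gt0// powR_gt0.
have Dt0 : 0 < Dt by rewrite divr_gt0// powR_gt0.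
split=> [x|]; first by rewrite /= in_itv/=; exact: jacobi_density_gt0.
exists ((Df + Dt) * 2) => x; rewrite /= in_itv/= => /andP[x_ge x_le].
have C0 : 0 < (Df + Dt) * 2 by rewrite mulr_gt0// addr_gt0.
(* At an endpoint the weight is [+oo] and the bound is trivial. *)
have [xend|/not_orP[/eqP xn1 /eqP xnN1]] := pselect (x = 1 \/ x = -1).
  by rewrite jacobi_density_end// gt0_muley ?lte_fin// leey.
have x_lt : -1 < x < 1 by rewrite !lt_neqAle x_ge x_le xn1 eq_sym xnN1.
have tf : 0 < side false x by rewrite /side; lra.
have tt : 0 < side true x by rewrite /side; lra.
apply: ub_ereal_sup => _ [I [itvI I11 Ix /andP[J0 Joo]] <-].
have mI : measurable I by exact: is_interval_measurable.
have := integral_jacobi_density_le (jacobi_measure alpha beta) _ _ _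
  (ltW a'0) (ltW b'0) mI I11.
have := ht x I itvI I11 Ix tt; have := hf x I itvI I11 Ix tf.
set F := (\int[_]_(y in _) epow (side false y) _)%E.
set T := (\int[_]_(y in _) epow (side true y) _)%E.
set W := (\int[_]_(y in _) jacobi_density _ _ _)%E.
move=> Fle Tle Wle; apply: lee_ediv; first by rewrite J0 Joo.
apply: (le_trans (le_trans Wle (leeD Fle Tle))).
rewrite -ge0_muleDl ?lee_fin ?mulr_ge0 ?powR_ge0 ?(ltW Cf0) ?(ltW Ct0)//.
rewrite -EFinD; apply: lee_wpmul2r => //.
have := jacobi_density_ge alpha' beta' x (ltW a'0) (ltW b'0) x_lt.
rewrite EFinM -muleA => /(lee_wpmul2l (_ : 0 <= (Df + Dt)%:E)%E) le.
apply: le_trans (le _); last by rewrite lee_fin addr_ge0 ?ltW.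
rewrite -EFinM lee_fin.
have pa : 0 < 2 `^ alpha' :> R by rewrite powR_gt0.
have pb : 0 < 2 `^ beta' :> R by rewrite powR_gt0.
have -> : Cf = Df * 2 `^ beta' by rewrite divfK// gt_eqF.
have -> : Ct = Dt * 2 `^ alpha' by rewrite divfK// gt_eqF.
have := powR_ge0 (side false x) alpha'.
have := powR_ge0 (side true x) beta'.
move: (_ `^ _) (_ `^ _) => u v u0 v0.
(* The two nonnegative cross terms in the expansion of the right-hand side. *)
have := mulr_ge0 (ltW Dt0) (mulr_ge0 (ltW pb) v0).
have := mulr_ge0 (ltW Df0) (mulr_ge0 (ltW pa) u0).
lra.
Qed.
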